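(* Let $(A,M,L)$ be a proper locally compact quantum metric space represented faithfully and nondegenerately on a Hilbert space $H$. Let $$\overline{A}^{H,\mathrm{comm}}=\{S\in\mathcal{M}(A): [S,T]\in\mathbb{K}(H)\text{ for all }T\in C^*_{\mathrm{comm}}(A)\}$$ be its relative commutant Higson compactification. Then $\overline{A}^{H,\mathrm{comm}}$ is a unital C*-subalgebra of the multiplier algebra $\mathcal{M}(A)$ that contains $A$. In other words, $(A,\overline{A}^{H,\mathrm{comm}})$ is a noncommutative coarse space.
   Context: Locally compact quantum metric spaces. Let $A$ be a C*-algebra, $\mathfrak{u}A$ its unitization ($\mathfrak{u}A=A$ if $A$ is unital), $\mathfrak{sa}(\cdot)$ the self-adjoint part, $\mathcal{S}(A)$ the state space. A Lipschitz pair $(A,L)$ consists of $A$ and a seminorm $L$ defined on a dense subspace $\mathrm{dom}(L)$ of $\mathfrak{sa}(\mathfrak{u}A)$ with $\{a:L(a)=0\}=\mathbb{R}1$; set $L(a)=\infty$ off $\mathrm{dom}(L)$. Put $\mathrm{mk}_L(\mu,\nu)=\sup\{|\mu(a)-\nu(a)|: a\in\mathfrak{sa}(\mathfrak{u}A), L(a)\le 1\}$ for $\mu,\nu\in\mathcal{S}(A)$. A Lipschitz triple $(A,M,L)$ is a Lipschitz pair with an abelian C*-subalgebra $M\subset A$ (the topography) containing an approximate unit for $A$; $\sigma(M)$ is its Gelfand spectrum. For $K\subset\sigma(M)$ compact, $\chi_K$ is the indicator function of $K$, viewed as a projection in $M^{**}\subset A^{**}$; states are extended normally to $A^{**}$.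 A state $\mu$ is local if $\mu(\chi_K)=1$ for some compact $K$. A set $\mathcal{S}\subset\mathcal{S}(A)$ is tame if for some (hence any) local state $\mu$, $\lim_{K}\sup\{|\varphi(a-\chi_Ka\chi_K)|:\varphi\in\mathcal{S},a\in\mathfrak{sa}(A),L(a)\le 1,\mu(a)=0\}=0$ (limit along compact $K\subset\sigma(M)$). $(A,M,L)$ is a locally compact quantum metric space if $\mathrm{mk}_L$ metrizes the weak* topology on every tame subset of $\mathcal{S}(A)$. Proper. Let $\mathfrak{Loc}(A)$ be the set of $a\in\mathfrak{sa}(A)\cap\mathrm{dom}(L)$ with $a=\chi_Ka\chi_K$ for some compact $K\subset\sigma(M)$. A locally compact quantum metric space is proper if: $A$ is separable; $\mathrm{dom}(L)$ is closed under $a\circ b=\frac{ab+ba}{2}$ and $\{a,b\}=\frac{ab-ba}{2i}$, and both $L(a\circ b)$ and $L(\{a,b\})$ are $\le\|a\|L(b)+L(a)\|b\|$; $L$ is norm lower semicontinuous; $\mathfrak{Loc}(A)$ is norm dense in $\mathrm{dom}(L)\cap\mathfrak{sa}(A)$; $\mathfrak{Loc}(A)\cap M$ is norm dense in $\mathfrak{sa}(M)$; and $\sigma(M)$ with the metric $d(x,y)=\sup\{|f(x)-f(y)|:f\in\mathfrak{sa}(M),L(f)\le1\}$ is a proper metric space (closed balls are compact). Relative commutant Roe algebra. Regard $A\subset\mathbb{B}(H)$ and $\mathcal{M}(A)\subset\mathbb{B}(H)$. For $T\in\mathbb{B}(H)$ let $L^*(T)=\sup\{\|[T,a]\|:a\in\mathfrak{sa}(A),L(a)\le1\}$.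 $T$ is locally compact if $Ta,aT\in\mathbb{K}(H)$ (compact operators) for all $a\in A$. $C^*_{\mathrm{comm}}(A)$ is the norm closure of $\{T\in\mathbb{B}(H):L^*(T)<\infty,\ T\text{ locally compact}\}$. A noncommutative coarse space is a pair $(A,\overline{A})$ with $A$ a C*-algebra and $\overline{A}$ a unital C*-subalgebra of $\mathcal{M}(A)$ containing $A$. *)

(* Defs.v *)
From HB Require Import structures.
From mathcomp Require Import all_boot all_order all_algebra.
From mathcomp Require Import all_classical all_reals all_analysis.
From mathcomp Require Import complex.

Set Implicit Arguments.
Unset Strict Implicit.
Unset Printing Implicit Defensive.

Import Order.TTheory GRing.Theory Num.Theory Num.Def.
Import numFieldNormedType.Exports.

Local Open Scope classical_set_scope.
Local Open Scope ring_scope.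
Local Open Scope complex_scope.

Reserved Notation "a ** b" (at level 40, left associativity).

(* Possibly non-unital complex C*-algebras; the ring structures of MathComp are
   all unital, so the product is a field of the mixin. *)
HB.mixin Record isCStarAlgebra (R : realType) A
    of CompleteNormedModule R[i] A := {
  cmul : A -> A -> A;
  star : A -> A;
  cmulA : associative cmul;
  cmulDl : left_distributive cmul +%R;
  cmulDr : right_distributive cmul +%R;
  cmulZl : forall (k : R[i]) (a b : A), cmul (k *: a) b = k *: cmul a b;
  cmulZr : forall (k : R[i]) (a b : A), cmul a (k *: b) = k *: cmul a b;
  starK : involutive star;
  starD : {morph star : a b / a + b};
  starZ : forall (k : R[i]) (a : A), star (k *: a) = conjC k *: star a;
  starM : forall a b : A, star (cmul a b) = cmul (star b) (star a);
  cnormM : forall a b : A, `|cmul a b| <= `|a| * `|b|;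
  cstar_id : forall a : A, `|cmul (star a) a| = `|a| ^+ 2
}.

#[short(type="cstarType")]
HB.structure Definition CStarAlgebra (R : realType) :=
  { A of isCStarAlgebra R A & CompleteNormedModule R[i] A }.

Notation "a ** b" := (cmul a b) : ring_scope.

Section Norms.
Context (R : realType).

(* Norms over R[i] are R[i]-valued; this is the underlying real number. *)
Definition nrm (V : normedModType R[i]) (x : V) : R := complex.Re `|x|.

Definition opnorm (V W : normedModType R[i]) (T : V -> W) : \bar R :=
  ereal_sup [set (nrm (T x))%:E | x in [set x : V | nrm x <= 1]].

Definition cabs (z : R[i]) : R := complex.Re `|z|.

Definition bounded_op (V W : normedModType R[i]) : set (V -> W) :=
  [set T | linear T /\ (opnorm T < +oo)%E].

Definition compact_op (V W : normedModType R[i]) : set (V -> W) :=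
  [set T | bounded_op T /\
           compact (closure (T @` [set x : V | nrm x <= 1]))].

End Norms.

Section CStar.
Context (R : realType).
Implicit Types A B U M : cstarType R.

Definition selfadj A : set A := [set a | star a = a].

Definition positive A : set A := [set a | exists b, a = star b ** b].

Definition is_one A (e : A) := forall a, e ** a = a /\ a ** e = a.

Definition star_hom A B (f : A -> B) :=
  [/\ linear f, {morph f : a b / a ** b} & {morph f : a / star a}].

(* [iota : A -> U] exhibits [U] as the unitization of [A]: if [A] is not unital
   then [U] is the direct sum of [iota A] and [C one], and if [A] is unital the
   last clause forces [one] into [iota A], so that [iota] is onto. *)
Definition is_unitization A U (iota : A -> U) (one : U) :=
  [/\ star_hom iota, injective iota, is_one one,
      forall u, exists a (k : R[i]), u = iota a + k *: one &
      forall a, is_one a -> iota a = one].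

Definition fnorm A (phi : A -> R[i]^o) : \bar R := @opnorm R A R[i]^o phi.

Definition dual A : set (A -> R[i]^o) :=
  [set phi | scalar phi /\ (fnorm phi < +oo)%E].

Definition state A : set (A -> R[i]^o) :=
  [set phi | [/\ scalar phi, forall a, 0 <= (phi (star a ** a) : R[i]) &
                 fnorm phi = 1%E]].

(* A** is the set of functionals on A* (only the values on [dual A] matter),
   the normal extension of [phi] in A* to A** is evaluation at [phi], and the
   product of A** is the Arens product. *)
Definition bidual A := (A -> R[i]^o) -> R[i]^o.

Definition bidual_ev A (a : A) : bidual A := fun phi => phi a.

Definition arens A (F G : bidual A) : bidual A :=
  fun phi => F (fun a => G (fun b => phi (a ** b))).

(* [j : M -> A] is the inclusion of an abelian C*-subalgebra containing an
   approximate unit (an increasing net of positive contractions) for [A]. *)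
Definition contains_approx_unit A M (j : M -> A) :=
  exists (I : Type) (le : I -> I -> Prop) (e : I -> M),
    [/\ inhabited I,
        [/\ forall i, le i i, forall h i k, le h i -> le i k -> le h k &
            forall i k, exists m, le i m /\ le k m],
        forall i, positive (e i) /\ nrm (e i) <= 1,
        forall i k, le i k -> positive (e k - e i) &
        forall (a : A) (eps : R), 0 < eps -> exists i0, forall i, le i0 i ->
          nrm (j (e i) ** a - a) < eps /\ nrm (a ** j (e i) - a) < eps].

Definition topography A M (j : M -> A) :=
  [/\ star_hom j, injective j, forall m n : M, m ** n = n ** m &
      contains_approx_unit j].

(* Gelfand spectrum, with the topology of pointwise convergence. *)
Definition spectrum M : set {ptws M -> R[i]^o} :=
  [set w : M -> R[i]^o | [/\ scalar w,
       forall m n, w (m ** n) = w m * w n & exists m, w m != 0]].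

Definition compact_spec M (K : set {ptws M -> R[i]^o}) :=
  K `<=` @spectrum M /\ compact K.

(* Elements of M whose Gelfand transform lies between the indicator function of
   K and 1; they are directed downwards and converge pointwise to it. *)
Definition above_ind M (K : set {ptws M -> R[i]^o}) : set M :=
  [set f | (forall w : M -> R[i]^o, spectrum w -> 0 <= (w f : R[i]) <= 1) /\
           (forall w : M -> R[i]^o, K w -> w f = 1)].

Definition ind_filter M (K : set {ptws M -> R[i]^o}) : set_system M :=
  [set S | exists2 f, above_ind K f &
     forall g, above_ind K g ->
       (forall w : M -> R[i]^o, spectrum w -> (w g : R[i]) <= w f) -> S g].

(* The indicator function of the compact set K as an element of M**, mapped into
   A** by restricting functionals to M.  A functional on M is integration
   against a regular complex Borel measure on the spectrum, and the measure
   of K is the limit of the integrals of the functions of [above_ind K]. *)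
Definition chi A M (j : M -> A) (K : set {ptws M -> R[i]^o}) : bidual A :=
  fun phi => lim (phi (j f) @[f --> ind_filter K]).

Definition compress A M (j : M -> A) (K : set {ptws M -> R[i]^o}) (a : A) :
    bidual A :=
  arens (arens (chi j K) (bidual_ev a)) (chi j K).

End CStar.

(* Metric notions for an extended-real-valued [d] on a subset [S]. *)
Section Metrics.
Context (R : realType) (X : Type) (d : X -> X -> \bar R) (S : set X).

Definition metric_on :=
  [/\ forall x y, S x -> S y -> (0 <= d x y < +oo)%E,
      forall x y, S x -> S y -> (d x y = 0%E <-> x = y),
      forall x y, S x -> S y -> d x y = d y x &
      forall x y z, S x -> S y -> S z -> (d x z <= d x y + d y z)%E].

Definition mball (x : X) (eps : R) : set X :=
  [set y | S y /\ (d x y < eps%:E)%E].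

Definition mclosed_ball (x : X) (r : R) : set X :=
  [set y | S y /\ (d x y <= r%:E)%E].

(* Compactness for the topology of [d] on [S]: same form as [compact]. *)
Definition mcompact (B : set X) :=
  forall F : set_system X, ProperFilter F -> F B ->
    exists2 x, B x & forall (eps : R) V, 0 < eps -> F V ->
      V `&` mball x eps !=set0.

Definition proper_metric :=
  metric_on /\ forall x r, S x -> mcompact (mclosed_ball x r).

End Metrics.

Definition metrizes (R : realType) (X : topologicalType)
    (d : X -> X -> \bar R) (S : set X) :=
  metric_on d S /\
  forall x V, S x -> (within S (nbhs x) V <->
    exists2 eps : R, 0 < eps & mball d S x eps `<=` V).

Section QuantumMetric.
Context (R : realType) (A U M : cstarType R).
Context (iota : A -> U) (one : U) (j : M -> A) (L : U -> \bar R).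

Definition domL : set U := [set u | (L u < +oo)%E].

Definition lipschitz_pair :=
  [/\ is_unitization iota one,
      domL `<=` @selfadj R U /\ @selfadj R U `<=` closure domL,
      forall u v, (0 <= L u)%E /\ (L (u + v)%R <= L u + L v)%E,
      forall (r : R) u, domL u -> L (r%:C *: u) = (`|r|%:E * L u)%E &
      forall u, L u = 0%E <-> exists r : R, u = r%:C *: one].

Definition lipschitz_triple := lipschitz_pair /\ topography j.

(* The value at [u] of the canonical unital extension of a state to [U]. *)
Definition unital_ext (phi : A -> R[i]^o) (u : U) : R[i]^o :=
  get [set z | exists a (k : R[i]),
    u = iota a + k *: one /\ z = phi a + (k : R[i]^o)].

Definition mk (mu nu : {ptws A -> R[i]^o}) : \bar R :=
  ereal_sup [set (cabs (unital_ext mu u - unital_ext nu u))%:E |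
    u in [set u | selfadj u /\ (L u <= 1)%E]].

Definition local_state (mu : A -> R[i]^o) :=
  state mu /\ exists2 K, compact_spec K & chi j K mu = 1.

Definition tame (S : set (A -> R[i]^o)) :=
  S `<=` @state R A /\
  exists2 mu, local_state mu &
  forall eps : R, 0 < eps -> exists2 K0, compact_spec K0 &
  forall K : set {ptws M -> R[i]^o}, compact_spec K -> K0 `<=` K ->
    (ereal_sup [set x | (exists phi a,
       [/\ S phi, selfadj a, (L (iota a) <= 1)%E, mu a = 0 &
           x = (cabs (phi a - compress j K a phi))%:E])%R] <= eps%:E)%E.

Definition lc_quantum_metric_space :=
  lipschitz_triple /\
  forall S : set {ptws A -> R[i]^o}, tame S -> metrizes mk S.

Definition Loc : set A :=
  [set a | [/\ selfadj a, domL (iota a) &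
     exists2 K, compact_spec K &
       forall phi, dual phi -> bidual_ev a phi = compress j K a phi]].

Definition jordan (u v : U) : U := 2^-1 *: (u ** v + v ** u).

Definition lie (u v : U) : U := (2 * 'i)^-1 *: (u ** v - v ** u).

Definition leibniz (op : U -> U -> U) :=
  forall u v, domL u -> domL v -> domL (op u v) /\
    (L (op u v) <= (nrm u)%:E * L v + L u * (nrm v)%:E)%E.

Definition spec_dist (x y : M -> R[i]^o) : \bar R :=
  ereal_sup [set (cabs (x f - y f))%:E |
    f in [set f | selfadj f /\ (L (iota (j f)) <= 1)%E]].

Definition proper_lc_quantum_metric_space :=
  lc_quantum_metric_space /\
  [/\ exists D : set A, countable D /\ dense D,
      leibniz jordan /\ leibniz lie,
      lower_semicontinuous L,
      [set a | selfadj a /\ domL (iota a)] `<=` closure Loc /\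
      j @` @selfadj R M `<=` closure (Loc `&` range j) &
      proper_metric spec_dist (@spectrum R M)].

End QuantumMetric.

Section Operators.
Context (R : realType) (H : completeNormedModType R[i]).
Context (dot : {dot H for conjC}).

Definition is_hilbert := forall x : H, `|x| ^+ 2 = dot x x.

Definition is_adjoint (T T' : H -> H) := forall x y, dot (T x) y = dot x (T' y).

Definition commutator (S T : H -> H) : H -> H := fun x => S (T x) - T (S x).

Definition op_closure (F : set (H -> H)) : set (H -> H) :=
  [set T | bounded_op T /\
     forall eps : R, 0 < eps -> exists2 S, F S & (opnorm (T \- S)%R <= eps%:E)%E].

Context (A U : cstarType R) (iota : A -> U) (L : U -> \bar R).
Context (pi : A -> H -> H).

Definition faithful_nondegenerate_rep :=
  [/\ forall a, bounded_op (pi a),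
      (forall x, linear (pi ^~ x)) /\
      (forall a b x, pi (a ** b) x = pi a (pi b x)),
      forall a, is_adjoint (pi a) (pi (star a)),
      injective pi &
      closure [set x | exists n (a : 'I_n -> A) (y : 'I_n -> H),
                 x = \sum_(k < n) pi (a k) (y k)] = setT].

(* M(A) realized in B(H): the idealizer of pi(A). *)
Definition multiplier : set (H -> H) :=
  [set S | bounded_op S /\ forall a,
     (exists b, S \o pi a = pi b) /\ (exists b, pi a \o S = pi b)].

Definition Lstar (T : H -> H) : \bar R :=
  ereal_sup [set opnorm (commutator T (pi a)) |
    a in [set a | selfadj a /\ (L (iota a) <= 1)%E]].

Definition locally_compact_op (T : H -> H) :=
  forall a, compact_op (T \o pi a) /\ compact_op (pi a \o T).

Definition Ccomm : set (H -> H) :=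
  op_closure [set T | [/\ bounded_op T, (Lstar T < +oo)%E &
                          locally_compact_op T]].

Definition higson_comm : set (H -> H) :=
  [set S | multiplier S /\ forall T, Ccomm T -> compact_op (commutator S T)].

Definition unital_cstar_subalgebra_of_multipliers (B : set (H -> H)) :=
  [/\ B `<=` multiplier, B id,
      (forall S T, B S -> B T -> B (S \+ T) /\ B (S \o T)) /\
      (forall (k : R[i]) S, B S -> B (fun x => k *: S x)),
      forall S, B S -> exists2 S', B S' & is_adjoint S S' &
      op_closure B `<=` B].

Definition nc_coarse_space (B : set (H -> H)) :=
  unital_cstar_subalgebra_of_multipliers B /\ range pi `<=` B.

End Operators.

(* Main.v *)
(* The relative commutant is closed under adjoints because [Ccomm] is, as
   [Lstar] takes the same value at [T] and at its adjoint.  It is norm closed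
   because a faithful representation is isometric, so that the range of [pi],
   hence also its idealizer, is norm closed.  Isometry is
   obtained without functional calculus: a self-adjoint [x] with [|x| <= 1]
   admits a formal square root [1 - x = (1 - b)^2], with [b] in [A] a limit of
   polynomials in [x].  If [c] is self-adjoint with [|pi c| <= 1] and
   [1 < |c|^2 <= 2], then this square root taken for [1 - x = (1 - c^2)^2]
   produces [f = c^2 - b], that is [2 (c^2 - 1)_+], for which [pi f = 0]; then
   [c^2 = b] has norm at most [1], a contradiction. *)
Require Import Defs.
From HB Require Import structures.
From mathcomp Require Import all_boot all_order all_algebra.
From mathcomp Require Import all_classical all_reals all_analysis.
From mathcomp Require Import complex.
From mathcomp Require Import ring lra.

Set Implicit Arguments.
Unset Strict Implicit.
Unset Printing Implicit Defensive.

Import Order.TTheory GRing.Theory Num.Theory Num.Def.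
Import numFieldNormedType.Exports.

Local Open Scope classical_set_scope.
Local Open Scope ring_scope.
Local Open Scope complex_scope.

(** * Real-valued norms and the topology they describe *)

Section Norm.
Context (R : realType) (V : normedModType R[i]).
Implicit Types (x y z : V) (k : R[i]).

Lemma cabsE k : `|k| = (cabs k)%:C.
Proof. by apply/esym/RRe_real/ger0_real. Qed.

Lemma nrmE x : `|x| = (nrm x)%:C.
Proof. by apply/esym/RRe_real/ger0_real. Qed.

Lemma nrm_ge0 x : 0 <= nrm x.
Proof. by rewrite -lecR -nrmE normr_ge0. Qed.

Lemma nrm0 : nrm (0 : V) = 0.
Proof. by apply: complexI; rewrite -nrmE normr0. Qed.

Lemma nrm0_eq0 x : nrm x = 0 -> x = 0.
Proof. by move=> x0; apply: normr0_eq0; rewrite nrmE x0. Qed.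

Lemma nrmN x : nrm (- x) = nrm x.
Proof. by apply: complexI; rewrite -!nrmE normrN. Qed.

Lemma nrmBC x y : nrm (x - y) = nrm (y - x).
Proof. by rewrite -opprB nrmN. Qed.

Lemma nrmD x y : nrm (x + y) <= nrm x + nrm y.
Proof. by rewrite -lecR rmorphD /= -!nrmE ler_normD. Qed.

Lemma nrmB x y : nrm (x - y) <= nrm x + nrm y.
Proof. by rewrite -(nrmN y) nrmD. Qed.

Lemma nrm_distD z x y : nrm (x - y) <= nrm (x - z) + nrm (z - y).
Proof. by rewrite -[x - y](subrKA z) nrmD. Qed.

Lemma nrmZ k x : nrm (k *: x) = cabs k * nrm x.
Proof. by apply: complexI; rewrite rmorphM /= -!nrmE -cabsE normrZ. Qed.

Lemma cabs_ge0 k : 0 <= cabs k.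
Proof. by rewrite -lecR -cabsE normr_ge0. Qed.

Lemma cabsC (r : R) : cabs r%:C = `|r|.
Proof. by rewrite /cabs normc_def /= expr0n addr0 sqrtr_sqr. Qed.

Lemma nrmZr (r : R) x : 0 <= r -> nrm (r%:C *: x) = r * nrm x.
Proof. by move=> r0; rewrite nrmZ cabsC ger0_norm. Qed.

Lemma nrm_small_eq0 x : (forall e : R, 0 < e -> nrm x <= e) -> x = 0.
Proof.
move=> small; apply: nrm0_eq0; apply/eqP; rewrite eq_le nrm_ge0 andbT.
by apply/ler_addgt0Pl => e /small; rewrite addr0.
Qed.

Lemma ball_nrmE x (e : R) : ball x e%:C = [set y | nrm (x - y) < e].
Proof.
rewrite -ball_normE /ball_ /=; apply/seteqP; split => y /=.
  by rewrite nrmE ltcR.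
by rewrite nrmE ltcR.
Qed.

Lemma posC (e : R[i]) : 0 < e -> e = (complex.Re e)%:C /\ 0 < complex.Re e.
Proof.
move=> e0; split; first exact/esym/RRe_real/gtr0_real.
by move: e0; rewrite ltcE => /andP[].
Qed.

Lemma nbhs_nrmP x (B : set V) :
  nbhs x B <-> exists2 e : R, 0 < e & [set y | nrm (x - y) < e] `<=` B.
Proof.
split.
  move=> /nbhs_ballP[e /= /posC[-> e0]]; rewrite ball_nrmE => sB.
  by exists (complex.Re e).
move=> [e e0 sB]; apply/nbhs_ballP; exists e%:C; first by rewrite /= ltcR.
by rewrite ball_nrmE.
Qed.

Lemma closure_nrmP (S : set V) x :
  closure S x <-> forall e : R, 0 < e -> exists2 y, S y & nrm (x - y) < e.
Proof.
split=> [clx e e0|clx B /nbhs_nrmP[e /clx[y Sy xy] sB]]; last first.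
  by exists y; split => //; apply: sB.
have [|y [Sy xy]] := clx [set y | nrm (x - y) < e]; last by exists y.
by apply/nbhs_nrmP; exists e.
Qed.

End Norm.

(** Completeness with an explicit error: the closed bound [e m] on the tail survives in the limit,
    so later arguments can use a rate of convergence instead of filters. *)
Lemma complete_nrm (R : realType) (V : completeNormedModType R[i])
    (u : nat -> V) (e : nat -> R) :
  (forall d : R, 0 < d -> exists m, e m < d) ->
  (forall m n, (m <= n)%N -> nrm (u n - u m) <= e m) ->
  exists l, forall m, nrm (l - u m) <= e m.
Proof.
move=> e_small ue.
have : cauchy (u @ \oo).
  apply: cauchy_exP => d /posC[-> /e_small[m em]]; exists (u m).
  rewrite ball_nrmE; exists m => // n /= mn.
  by rewrite nrmBC; apply: le_lt_trans (ue _ _ mn) em.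
move=> /cauchy_cvg/cvg_ex[l ul]; exists l => m.
apply/ler_addgt0Pl => d d0.
have [|N _ Nl] := ul [set y | nrm (l - y) < d].
  by apply/nbhs_nrmP; exists d.
apply: le_trans (nrm_distD (u (maxn m N)) _ _) _.
by rewrite lerD ?ue ?leq_maxl // ltW // Nl //= leq_maxr.
Qed.

(** * Linear maps, operator norms and bounded operators *)

Section Linear.
Context (R : realType) (V W : normedModType R[i]) (T : V -> W).
Context (linT : linear T).

Lemma linB x y : T (x - y) = T x - T y.
Proof. by rewrite addrC -scaleN1r linT scaleN1r addrC. Qed.

Lemma lin0 : T 0 = 0.
Proof. by rewrite -[0 in LHS](subrr 0) linB subrr. Qed.

Lemma linZ k x : T (k *: x) = k *: T x.
Proof. by have := linT k x 0; rewrite lin0 !addr0. Qed.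

Lemma linN x : T (- x) = - T x.
Proof. by rewrite -sub0r linB lin0 sub0r. Qed.

Lemma linD x y : T (x + y) = T x + T y.
Proof. by rewrite -[y in LHS]opprK linB linN opprK. Qed.

Lemma opnorm_leP (C : R) : 0 <= C ->
  (opnorm T <= C%:E)%E <-> forall x, nrm (T x) <= C * nrm x.
Proof.
move=> C0; split=> [TC x|TC]; last first.
  apply: ge_ereal_sup => _ [x /= x1 <-]; rewrite lee_fin.
  by apply: le_trans (TC x) _; rewrite ler_piMr.
have unit_le y : nrm y <= 1 -> nrm (T y) <= C.
  move=> y1; rewrite -lee_fin; apply: le_trans TC.
  by apply: ereal_sup_ubound; exists y.
have [/nrm0_eq0 ->|x0] := eqVneq (nrm x) 0; first by rewrite lin0 !nrm0 mulr0.
have x_gt0 : 0 < nrm x by rewrite lt_def x0 nrm_ge0.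
have := unit_le ((nrm x)^-1%:C *: x).
rewrite linZ !nrmZr ?invr_ge0 ?nrm_ge0 // mulVf // => /(_ (lexx _)).
by rewrite mulrC ler_pdivrMr.
Qed.

Lemma opnorm_ge0 : (0 <= opnorm T)%E.
Proof.
by apply: ereal_sup_ubound; exists 0; rewrite /= ?lin0 nrm0 ?ler01.
Qed.

End Linear.

Lemma bounded_opP (R : realType) (V W : normedModType R[i]) (T : V -> W) :
  bounded_op T <->
  linear T /\ exists2 C : R, 0 <= C & forall x, nrm (T x) <= C * nrm x.
Proof.
split=> [[linT Tfin]|[linT [C C0 TC]]]; split => //; last first.
  by apply: le_lt_trans (ltry C); apply/opnorm_leP.
have fT : opnorm T \is a fin_num by rewrite ge0_fin_numE ?opnorm_ge0.
exists (fine (opnorm T)); first by rewrite fine_ge0 ?opnorm_ge0.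
by apply/opnorm_leP; rewrite ?fineK ?fine_ge0 ?opnorm_ge0.
Qed.

Section BoundedOperators.
Context (R : realType).
Implicit Types U V W : normedModType R[i].

Lemma bounded_op_id V : bounded_op (@id V).
Proof. by apply/bounded_opP; split => //; exists 1 => // x; rewrite mul1r. Qed.

Lemma bounded_opD V W (S T : V -> W) :
  bounded_op S -> bounded_op T -> bounded_op (S \+ T).
Proof.
move=> /bounded_opP[lS [C C0 SC]] /bounded_opP[lT [D D0 TD]].
apply/bounded_opP; split.
  by move=> k x y /=; rewrite lS lT scalerDr addrACA.
exists (C + D); first exact: addr_ge0.
by move=> x /=; apply: le_trans (nrmD _ _) _; rewrite mulrDl lerD.
Qed.

Lemma bounded_op_comp U V W (S : V -> W) (T : U -> V) :
  bounded_op S -> bounded_op T -> bounded_op (S \o T).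
Proof.
move=> /bounded_opP[lS [C C0 SC]] /bounded_opP[lT [D D0 TD]].
apply/bounded_opP; split; first by move=> k x y /=; rewrite lT lS.
exists (C * D); first exact: mulr_ge0.
by move=> x /=; apply: le_trans (SC _) _; rewrite -mulrA ler_wpM2l.
Qed.

Lemma bounded_opZ V W (k : R[i]) (T : V -> W) :
  bounded_op T -> bounded_op (fun x => k *: T x).
Proof.
move=> /bounded_opP[lT [C C0 TC]]; apply/bounded_opP; split.
  by move=> a x y; rewrite lT scalerDr !scalerA mulrC.
exists (cabs k * C); first by rewrite mulr_ge0 ?cabs_ge0.
by move=> x; rewrite nrmZ -mulrA ler_wpM2l ?cabs_ge0.
Qed.

Lemma bounded_opB V W (S T : V -> W) :
  bounded_op S -> bounded_op T -> bounded_op (S \- T).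
Proof.
move=> bS /(bounded_opZ (- 1))/(bounded_opD bS); congr bounded_op.
by apply/funext => x /=; rewrite scaleN1r.
Qed.

End BoundedOperators.

(** * Compact operators through total boundedness *)

Section CompactOperators.
Context (R : realType).

(** The centres of the net may lie outside [S], so that nets can be added, rescaled and mapped
    freely. *)
Definition totally_bounded_set (V : normedModType R[i]) (S : set V) :=
  forall e : R, 0 < e -> exists s : seq V,
    forall x, S x -> exists2 y, y \in s & nrm (x - y) < e.

Lemma compact_closure_totally_bounded (V : normedModType R[i]) (S : set V) :
  compact (closure S) -> totally_bounded_set S.
Proof.
move=> + e e0; rewrite compact_cover => cS.
have e0C : 0 < e%:C by rewrite ltcR.
have [|x clx|s _ scov] := cS V (closure S) (fun x => (ball x e%:C)°).
- by move=> x _; exact: open_interior.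
- by exists x => //; apply: nbhsx_ballx.
exists (finmap.enum_fset s) => x /subset_closure/scov[y sy /interior_subset].
by rewrite ball_nrmE => /= yx; exists y => //; rewrite nrmBC.
Qed.

(** An ultrafilter on the closure contains a ball of every prescribed radius, since finitely many
    such balls cover; it is therefore Cauchy and converges. *)
Lemma totally_bounded_compact_closure (V : completeNormedModType R[i])
    (S : set V) :
  totally_bounded_set S -> compact (closure S).
Proof.
rewrite compact_ultra => tbS F FU FclS.
have : cauchy F.
  apply: cauchy_exP => d /posC[-> d0].
  have [s snet] := tbS _ (divr_gt0 d0 (ltr0n R 2)).
  have : F (fun x => exists2 y, y \in s & nrm (x - y) < complex.Re d).
    apply: filterS FclS => x /closure_nrmP/(_ _ (divr_gt0 d0 (ltr0n R 2))).
    move=> [z /snet[y sy zy] xz]; exists y => //.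
    by apply: le_lt_trans (nrm_distD z _ _) _; rewrite [ltRHS]splitr ltrD.
  elim: s {snet} => [|y s IH] Fs.
    by exfalso; apply: (filter_not_empty F); apply: filterS Fs => x [].
  have [Fy|Fy] := in_ultra_setVsetC [set x | nrm (x - y) < complex.Re d] FU.
    by exists y; rewrite ball_nrmE; apply: filterS Fy => x /=; rewrite nrmBC.
  apply: IH; apply: filterS2 Fs Fy => x [z]; rewrite inE => /orP[/eqP->//|sz].
  by exists z.
move=> /cauchy_cvg/cvg_ex[l Fl]; exists l; split => //.
apply: closed_closure => B /Fl FB.
by have [x [? ?]] := filter_ex (filterI FclS FB); exists x.
Qed.

Context (H : completeNormedModType R[i]).
Implicit Types S T : H -> H.

Lemma compact_opP T : compact_op T <->
  bounded_op T /\ totally_bounded_set (T @` [set x | nrm x <= 1]).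
Proof.
split=> -[bT cT]; split => //; first exact: compact_closure_totally_bounded.
exact: totally_bounded_compact_closure.
Qed.

Lemma compact_opD S T : compact_op S -> compact_op T -> compact_op (S \+ T).
Proof.
move=> /compact_opP[bS tS] /compact_opP[bT tT]; apply/compact_opP.
split=> [|e e0]; first exact: bounded_opD.
have e2 : 0 < e / 2 by rewrite divr_gt0.
have [s snet] := tS _ e2; have [t tnet] := tT _ e2.
exists [seq y + z | y <- s, z <- t] => _ [x /= x1 <-].
have [y ys xy] := snet _ (imageP S (x1 : [set x | nrm x <= 1] x)).
have [z zt xz] := tnet _ (imageP T (x1 : [set x | nrm x <= 1] x)).
exists (y + z); first by apply/allpairsP; exists (y, z).
rewrite opprD addrACA; apply: le_lt_trans (nrmD _ _) _.
by rewrite [ltRHS]splitr ltrD.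
Qed.

Lemma compact_op_compl S T : bounded_op S -> compact_op T -> compact_op (S \o T).
Proof.
move=> bS /compact_opP[bT tT]; apply/compact_opP.
split=> [|e e0]; first exact: bounded_op_comp.
have /bounded_opP[lS [C C0 SC]] := bS.
(* The bound [C] may be zero; [C + 1] is a safe divisor. *)
have C1 : 0 < C + 1 by rewrite ltr_wpDl.
have [s snet] := tT _ (divr_gt0 e0 C1).
exists [seq S y | y <- s] => _ [x /= x1 <-].
have [y ys xy] := snet _ (imageP T (x1 : [set x | nrm x <= 1] x)).
exists (S y); first exact: map_f.
rewrite -linB //; apply: le_lt_trans (SC _) _.
apply: (@le_lt_trans _ _ ((C + 1) * nrm (T x - y))).
  by rewrite ler_wpM2r ?nrm_ge0 // lerDl.
by rewrite mulrC -ltr_pdivlMr.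
Qed.

Lemma compact_op_compr S T : compact_op S -> bounded_op T -> compact_op (S \o T).
Proof.
move=> /compact_opP[bS tS] bT; apply/compact_opP.
split=> [|e e0]; first exact: bounded_op_comp.
have /bounded_opP[lT [C C0 TC]] := bT; have [lS _] := bS.
have C1 : 0 < C + 1 by rewrite ltr_wpDl.
have [s snet] := tS _ (divr_gt0 e0 C1).
exists [seq (C + 1)%:C *: y | y <- s] => _ [x /= x1 <-].
(* [T] shrunk by [C + 1] maps the unit ball into itself, so the net of [S] applies; the chosen
   centres are scaled back afterwards. *)
have Tx1 : [set x | nrm x <= 1] ((C + 1)^-1%:C *: T x).
  rewrite /= nrmZr ?invr_ge0 ?(ltW C1) // mulrC ler_pdivrMr // mul1r.
  apply: le_trans (TC x) _; rewrite (@le_trans _ _ C) ?lerDl //.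
  by rewrite ler_piMr.
have [y ys xy] := snet _ (imageP S Tx1).
exists ((C + 1)%:C *: y); first exact: (map_f (fun y => (C + 1)%:C *: y)).
have -> : S (T x) = (C + 1)%:C *: S ((C + 1)^-1%:C *: T x).
  by rewrite linZ // scalerA -rmorphM /= divff ?gt_eqF // scale1r.
by rewrite -scalerBr nrmZr ?(ltW C1) // mulrC -ltr_pdivlMr.
Qed.

Lemma compact_opZ (k : R[i]) T : compact_op T -> compact_op (fun x => k *: T x).
Proof.
exact: (compact_op_compl (bounded_opZ k (bounded_op_id H))).
Qed.

Lemma compact_op0 : compact_op (fun _ : H => 0 : H).
Proof.
apply/compact_opP; split.
  apply/bounded_opP; split; first by move=> k x y; rewrite scaler0 addr0.
  by exists 0 => // x; rewrite nrm0 mul0r.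
move=> e e0; exists [:: 0] => _ [x _ <-]; exists 0; rewrite ?inE //.
by rewrite subrr nrm0.
Qed.

Lemma compact_opB S T : compact_op S -> compact_op T -> compact_op (S \- T).
Proof.
move=> cS /(compact_opZ (- 1))/(compact_opD cS); congr compact_op.
by apply/funext => x /=; rewrite scaleN1r.
Qed.

Lemma compact_op_limit T : bounded_op T ->
  (forall e : R, 0 < e -> exists2 S, compact_op S &
     forall x, nrm (T x - S x) <= e * nrm x) ->
  compact_op T.
Proof.
move=> bT lim_T; apply/compact_opP; split => // e e0.
have e2 : 0 < e / 2 by rewrite divr_gt0.
have [S /compact_opP[bS tS] TS] := lim_T _ e2.
have [s snet] := tS _ e2; exists s => _ [x /= x1 <-].
have [y ys xy] := snet _ (imageP S (x1 : [set x | nrm x <= 1] x)).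
exists y => //; apply: le_lt_trans (nrm_distD (S x) _ _) _.
rewrite [ltRHS]splitr ler_ltD //; apply: le_trans (TS x) _.
by rewrite ler_piMr // ltW.
Qed.

End CompactOperators.

(** * Hilbert space geometry, Riesz representation and adjoints *)

Section Hilbert.
Context (R : realType) (H : completeNormedModType R[i]).
Context (dot : {dot H for conjC}) (hilbH : is_hilbert dot).
Implicit Types (x y u v w : H) (T : H -> H).

(** The real part is a real inner product with the same norm, which keeps the estimates inside the
    ordered field [R]; [dot_from_rdot] recovers the complex statements. *)
Definition rdot x y : R := complex.Re (dot x y).

Lemma dotC x y : dot y x = conjc (dot x y).
Proof. by rewrite hermC expr0 mul1r. Qed.

Lemma rdotC x y : rdot x y = rdot y x.
Proof. by rewrite /rdot dotC; case: (dot y x). Qed.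

Lemma rdotDl x y z : rdot (x + y) z = rdot x z + rdot y z.
Proof. by rewrite /rdot linearDl raddfD. Qed.

Lemma rdotNl x z : rdot (- x) z = - rdot x z.
Proof. by rewrite /rdot linearNl raddfN. Qed.

Lemma rdotDr x y z : rdot z (x + y) = rdot z x + rdot z y.
Proof. by rewrite !(rdotC z) rdotDl. Qed.

Lemma rdot0r z : rdot z 0 = 0.
Proof. by rewrite /rdot linear0r. Qed.

Lemma rdotNr x z : rdot z (- x) = - rdot z x.
Proof. by rewrite !(rdotC z) rdotNl. Qed.

Lemma rdotZl (t : R) x z : rdot (t%:C *: x) z = t * rdot x z.
Proof.
by rewrite /rdot linearZl_LR /=; case: (dot x z) => a b /=; rewrite mul0r subr0.
Qed.

Lemma rdotZr (t : R) x z : rdot z (t%:C *: x) = t * rdot z x.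
Proof. by rewrite !(rdotC z) rdotZl. Qed.

Lemma rdotxx x : rdot x x = nrm x ^+ 2.
Proof. by apply: complexI; rewrite /rdot -hilbH nrmE -rmorphXn. Qed.

Lemma nrmD_sqr x y : nrm (x + y) ^+ 2 = nrm x ^+ 2 + 2 * rdot x y + nrm y ^+ 2.
Proof. by rewrite -!rdotxx rdotDl !rdotDr (rdotC y x); ring. Qed.

Lemma nrmB_sqr x y : nrm (x - y) ^+ 2 = nrm x ^+ 2 - 2 * rdot x y + nrm y ^+ 2.
Proof. by rewrite nrmD_sqr nrmN rdotNr; ring. Qed.

Lemma parallelogram x y :
  nrm (x + y) ^+ 2 + nrm (x - y) ^+ 2 = 2 * nrm x ^+ 2 + 2 * nrm y ^+ 2.
Proof. by rewrite nrmD_sqr nrmB_sqr; ring. Qed.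

(** Cauchy-Schwarz: the square of the norm of [|y|^2 x - (x,y) y] equals
    [|y|^2 (|y|^2 |x|^2 - (x,y)^2)]. *)
Lemma rdot_le x y : rdot x y <= nrm x * nrm y.
Proof.
have [y0|y0] := eqVneq (nrm y) 0.
  by rewrite (nrm0_eq0 y0) rdot0r nrm0 mulr0.
have y_gt0 : 0 < nrm y by rewrite lt_def y0 nrm_ge0.
have [xy0|xy0] := leP (rdot x y) 0.
  by apply: le_trans xy0 _; rewrite mulr_ge0 ?nrm_ge0.
rewrite -(@ler_pXn2r _ 2) ?nnegrE ?mulr_ge0 ?nrm_ge0 ?(ltW xy0) //.
have := sqr_ge0 (nrm ((nrm y ^+ 2)%:C *: x - (rdot x y)%:C *: y)).
rewrite nrmB_sqr rdotZl rdotZr !nrmZr ?sqr_ge0 ?(ltW xy0) // => P.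
have {}P : 0 <= nrm y ^+ 2 * (nrm y ^+ 2 * nrm x ^+ 2 - rdot x y ^+ 2).
  by apply: le_trans P _; rewrite le_eqVlt; apply/orP; left; apply/eqP; ring.
by move: P; rewrite pmulr_rge0 ?exprn_gt0 // subr_ge0 exprMn mulrC.
Qed.

Lemma rdot_ge x y : - (nrm x * nrm y) <= rdot x y.
Proof. by rewrite lerNl -rdotNl -(nrmN x) rdot_le. Qed.

Lemma rdot_inj x y : (forall u, rdot u x = rdot u y) -> x = y.
Proof.
move=> xy; apply/eqP; rewrite -subr_eq0; apply/eqP/nrm0_eq0/eqP.
by rewrite -sqrf_eq0 -rdotxx rdotDr rdotNr xy subrr.
Qed.

(* The representing vector minimizes [|u|^2 - 2 f u]. *)
Lemma riesz (f : H -> R) (C : R) :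
    (forall u v, f (u + v) = f u + f v) ->
    (forall (t : R) u, f (t%:C *: u) = t * f u) ->
    (forall u, f u <= C * nrm u) ->
  exists w, forall u, rdot u w = f u.
Proof.
move=> fD fZ fC; pose J u := nrm u ^+ 2 - 2 * f u.
have infJ : has_inf (range J).
  split; first by exists (J 0), 0.
  (* [J u >= |u|^2 - 2 C |u| = (|u| - C)^2 - C^2]. *)
  exists (- C ^+ 2) => _ [u _ <-]; rewrite /J.
  have := fC u; have := sqr_ge0 (nrm u - C); nra.
pose m := inf (range J).
have mJ u : m <= J u by apply: ge_inf; [case: infJ|exists u].
pose d n : R := n.+1%:R^-1.
have d_gt0 n : 0 < d n by rewrite invr_gt0.
have d_small e : 0 < e -> exists n, d n < e.
  move=> e0; exists (Num.truncn e^-1); rewrite /d -[ltRHS]invrK.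
  by rewrite ltf_pV2 ?posrE ?invr_gt0 ?truncnS_gt.
(* By the parallelogram law, [|u q - u p|^2] is [2 J (u q) + 2 J (u p)] minus four times the value
   of [J] at the midpoint, which is at least [m]; this tolerance turns that into the bound [d p]. *)
have /choice[u uJ] : forall n, exists u, J u < m + (d n / 2) ^+ 2.
  move=> n; have e0 : 0 < (d n / 2) ^+ 2 by rewrite exprn_gt0 // divr_gt0.
  by have [_ [u _ <-]] := inf_adherent e0 infJ; exists u.
have u_cauchy p q : (p <= q)%N -> nrm (u q - u p) <= d p.
  move=> pq; rewrite -(@ler_pXn2r _ 2) ?nnegrE ?nrm_ge0 ?(ltW (d_gt0 _)) //.
  have dqp : d q <= d p by rewrite lef_pV2 ?posrE // ler_nat.
  have := parallelogram (u q) (u p); have := uJ q; have := uJ p.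
  have := mJ ((2^-1 : R)%:C *: (u q + u p)).
  rewrite /J fZ fD nrmZr ?invr_ge0 // => Jmid Jp Jq par.
  have dsq : d q ^+ 2 <= d p ^+ 2 by rewrite ler_pXn2r ?nnegrE ?(ltW (d_gt0 _)).
  move: Jmid Jp Jq par dsq; rewrite !expr_div_n !exprMn exprVn; lra.
have [w uw] := complete_nrm d_small u_cauchy.
exists w => h; apply/eqP; rewrite -subr_eq0 rdotC; apply/eqP.
have [h0|h0] := eqVneq (nrm h) 0.
  rewrite (nrm0_eq0 h0); have := fZ 0 0; rewrite scaler0 mul0r => ->.
  by rewrite rdot0r subr0.
have h_gt0 : 0 < nrm h by rewrite lt_def h0 nrm_ge0.
apply/normr0_eq0/eqP; rewrite eq_le normr_ge0 andbT; apply/ler_addgt0Pl => e e0.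
have [n dn] := d_small _ (divr_gt0 e0 (mulr_gt0 (ltr0n R 2) h_gt0)).
rewrite addr0; apply: le_trans (_ : 2 * nrm h * d n <= e); last first.
  by rewrite mulrC -ler_pdivlMr ?mulr_gt0 // ltW.
have approx : `|rdot (u n) h - f h| <= d n * nrm h.
  set a := rdot _ _ - _.
  have Jn : nrm (u n) ^+ 2 - 2 * f (u n) < m + (d n / 2) ^+ 2 := uJ n.
  (* This multiple of [h] minimizes [J] on the line through [u n] in direction [h], where [J] drops
     by [a^2 / |h|^2]; the drop cannot exceed the distance of [J (u n)] from [m]. *)
  have := mJ (u n + (- (a / nrm h ^+ 2))%:C *: h).
  rewrite /J nrmD_sqr fD fZ rdotZr nrmZ cabsC exprMn real_normK ?num_real // => Jt.
  rewrite -(@ler_pXn2r _ 2) ?nnegrE ?mulr_ge0 ?nrm_ge0 ?(ltW (d_gt0 _)) //.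
  rewrite real_normK ?num_real //.
  have h2 : 0 < nrm h ^+ 2 by rewrite exprn_gt0.
  have {Jt} : a ^+ 2 / nrm h ^+ 2 <= (d n / 2) ^+ 2.
    have : 2 * (- (a / nrm h ^+ 2) * a) + (- (a / nrm h ^+ 2)) ^+ 2 * nrm h ^+ 2
           = - (a ^+ 2 / nrm h ^+ 2) by field.
    rewrite /a in Jt *; lra.
  rewrite ler_pdivrMr // => /le_trans; apply.
  rewrite [leRHS]exprMn ler_wpM2r ?(ltW h2) //.
  rewrite expr_div_n; have := sqr_ge0 (d n); lra.
have near_w : `|rdot (w - u n) h| <= d n * nrm h.
  rewrite ler_norml; apply/andP; split.
    by apply: le_trans (rdot_ge _ _); rewrite lerN2 ler_wpM2r ?nrm_ge0.
  by apply: le_trans (rdot_le _ _) _; rewrite ler_wpM2r ?nrm_ge0.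
have -> : rdot w h - f h = rdot (w - u n) h + (rdot (u n) h - f h).
  by rewrite rdotDl rdotNl; ring.
by apply: le_trans (ler_normD _ _) _; lra.
Qed.

(** Testing the real identity at ['i *: u] yields the imaginary parts. *)
Lemma dot_from_rdot T x w : linear T ->
  (forall u, rdot (T u) x = rdot u w) -> forall u, dot (T u) x = dot u w.
Proof.
move=> lT Tw u; have := Tw u; have := Tw ('i%C *: u).
rewrite /rdot linZ // !linearZl_LR /=.
case: (dot (T u) x) => a b; case: (dot u w) => c d /=.
by rewrite !mul0r !mul1r !sub0r => /oppr_inj -> ->.
Qed.

Lemma adjoint_rdot T T' : is_adjoint dot T T' ->
  forall x y, rdot (T x) y = rdot x (T' y).
Proof. by move=> TT' x y; rewrite /rdot TT'. Qed.

Lemma adjoint_sym T T' : is_adjoint dot T T' -> is_adjoint dot T' T.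
Proof. by move=> TT' x y; rewrite dotC -TT' dotC conjcK. Qed.

Lemma dot_inj x y : (forall u, dot u x = dot u y) -> x = y.
Proof. by move=> xy; apply: rdot_inj => u; rewrite /rdot xy. Qed.

Lemma adjoint_unique T T1 T2 :
  is_adjoint dot T T1 -> is_adjoint dot T T2 -> T1 = T2.
Proof.
by move=> a1 a2; apply/funext => y; apply: dot_inj => u; rewrite -a1 -a2.
Qed.

Lemma adjoint_linear T T' : is_adjoint dot T T' -> linear T'.
Proof.
move=> TT' k x y; apply: dot_inj => u.
by rewrite -TT' !linearDr !linearZr_LR /= !TT'.
Qed.

(** [|T'x|^2 = (TT'x, x) <= C |T'x| |x|], then cancel [|T'x|]. *)
Lemma adjoint_le T T' (C : R) : is_adjoint dot T T' ->
  (forall x, nrm (T x) <= C * nrm x) -> forall x, nrm (T' x) <= C * nrm x.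
Proof.
move=> TT' TC x; have [->|T'x0] := eqVneq (nrm (T' x)) 0.
  apply: le_trans (TC x); exact: nrm_ge0.
have T'x_gt0 : 0 < nrm (T' x) by rewrite lt_def T'x0 nrm_ge0.
rewrite -(ler_pM2l T'x_gt0) -expr2 -rdotxx -(adjoint_rdot TT').
apply: le_trans (rdot_le _ _) _; rewrite mulrA (mulrC (nrm _) C).
by rewrite ler_wpM2r ?nrm_ge0.
Qed.

Lemma bounded_op_adjoint T T' :
  is_adjoint dot T T' -> bounded_op T -> bounded_op T'.
Proof.
move=> TT' /bounded_opP[lT [C C0 TC]]; apply/bounded_opP; split.
  exact: adjoint_linear TT'.
by exists C => //; apply: adjoint_le TT' TC.
Qed.

(** The value at [y] represents the real functional [u |-> Re (Tu, y)], bounded by [C |y|]. *)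
Lemma adjoint_exists T : bounded_op T -> exists T', is_adjoint dot T T'.
Proof.
move=> /bounded_opP[lT [C C0 TC]].
have /choice[T' T'P] : forall y, exists w, forall u, rdot u w = rdot (T u) y.
  move=> y; apply: (@riesz _ (C * nrm y)) => [u v|t u|u].
  - by rewrite linD // rdotDl.
  - by rewrite linZ // rdotZl.
  apply: le_trans (rdot_le _ _) _.
  by rewrite mulrAC ler_wpM2r ?nrm_ge0.
by exists T' => x y; apply: dot_from_rdot.
Qed.

(* [|T'x|^2 = <TT'x, x>], so a net for the image of [TT'] yields one for
   that of [T']. *)
Lemma compact_op_adjoint T T' :
  is_adjoint dot T T' -> compact_op T -> compact_op T'.
Proof.
move=> TT' cT; have bT' := bounded_op_adjoint TT' cT.1.
apply/compact_opP; split => // e e0.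
have lT := cT.1.1; have lT' := bT'.1.
(* Two points of the unit ball are at distance at most 2, so this radius gives
   [|T'(x - z)|^2 <= 2 (e^2 / 4) < e^2]. *)
have d0 : 0 < e ^+ 2 / 4 by rewrite divr_gt0 // exprn_gt0.
have d2 : 0 < e ^+ 2 / 4 / 2 by rewrite divr_gt0.
have [s snet] := ((compact_opP _).1 (compact_op_compr cT bT')).2 _ d2.
pose B := [set x : H | nrm x <= 1].
pose near_net y := [set x | B x /\ nrm (T (T' x) - y) < e ^+ 2 / 4 / 2].
(* Each centre [y] is replaced by a vector of the unit ball that [TT'] sends near [y]; the default 0
   only occurs for centres near no image point, and these are never selected. *)
exists [seq T' (xget 0 (near_net y)) | y <- s] => _ [x /= x1 <-].
have [y ys xy] := snet _ (imageP _ (x1 : B x)).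
exists (T' (xget 0 (near_net y))); first exact: (map_f (fun y => T' _)).
have [z1 zy] : near_net y (xget 0 (near_net y)) by apply: xgetPex; exists x.
set z := xget _ _ in z1 zy *.
rewrite -linB // -(@ltr_pXn2r _ 2) ?nnegrE ?nrm_ge0 ?(ltW e0) //.
rewrite -rdotxx -(adjoint_rdot TT'); apply: le_lt_trans (rdot_le _ _) _.
have TT'xz : nrm (T (T' (x - z))) < e ^+ 2 / 4.
  rewrite !linB //; apply: le_lt_trans (nrm_distD y _ _) _.
  by rewrite (nrmBC y) [ltRHS]splitr ltrD.
have xz2 : nrm (x - z) <= 2.
  by apply: le_trans (nrmB _ _) _; rewrite -[2]/(1 + 1) lerD.
apply: (@le_lt_trans _ _ (e ^+ 2 / 4 * 2)).
  by rewrite ler_pM ?nrm_ge0 // ltW.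
have := exprn_gt0 2 e0; lra.
Qed.

End Hilbert.

(** * Norm identities and formal square roots in a C*-algebra without unit *)

Section CStarNorm.
Context (R : realType) (A : cstarType R).
Implicit Types (a b c d s v x z : A) (k : R[i]).

Lemma cmulNl a b : (- a) ** b = - (a ** b).
Proof. by rewrite -scaleN1r cmulZl scaleN1r. Qed.

Lemma cmulNr a b : a ** (- b) = - (a ** b).
Proof. by rewrite -scaleN1r cmulZr scaleN1r. Qed.

Lemma cmulBl a b c : (a - b) ** c = a ** c - b ** c.
Proof. by rewrite cmulDl cmulNl. Qed.

Lemma cmulBr a b c : a ** (b - c) = a ** b - a ** c.
Proof. by rewrite cmulDr cmulNr. Qed.

Lemma cmul0l a : 0 ** a = 0.
Proof. by have := cmulBl 0 0 a; rewrite !subrr. Qed.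

Lemma cmul0r a : a ** 0 = 0.
Proof. by have := cmulBr a 0 0; rewrite !subrr. Qed.

Lemma starN a : star (- a) = - star a.
Proof. by rewrite -scaleN1r starZ rmorphN1 scaleN1r. Qed.

Lemma starB a b : star (a - b) = star a - star b.
Proof. by rewrite starD starN. Qed.

Lemma starZr (t : R) a : star (t%:C *: a) = t%:C *: star a.
Proof. by rewrite starZ; congr (_ *: _); exact: conjc_real. Qed.

Lemma star0 : star (0 : A) = 0.
Proof. by have := starB 0 0; rewrite !subrr. Qed.

Lemma nrm_cmul a b : nrm (a ** b) <= nrm a * nrm b.
Proof. by rewrite -lecR rmorphM /= -!nrmE cnormM. Qed.

Lemma nrm_star_cmul a : nrm (star a ** a) = nrm a ^+ 2.
Proof. by apply: complexI; rewrite rmorphXn /= -!nrmE cstar_id. Qed.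

(** The C*-identity gives [|b|^2 <= |star b| |b|]; apply the resulting inequality to [a] and to
    [star a]. *)
Lemma nrm_star a : nrm (star a) = nrm a.
Proof.
have le_star b : nrm b <= nrm (star b).
  have [->|b0] := eqVneq (nrm b) 0; first exact: nrm_ge0.
  have b_gt0 : 0 < nrm b by rewrite lt_def b0 nrm_ge0.
  by rewrite -(ler_pM2r b_gt0) -expr2 -nrm_star_cmul nrm_cmul.
by apply/le_anti; rewrite le_star -{2}(starK a) le_star.
Qed.

Lemma nrm_sqr_selfadj a : selfadj a -> nrm (a ** a) = nrm a ^+ 2.
Proof. by move=> sa; rewrite -nrm_star_cmul sa. Qed.

Lemma selfadj_sqr a : selfadj a -> selfadj (a ** a).
Proof. by move=> sa; rewrite /selfadj /= starM sa. Qed.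

Lemma nrm_half a : nrm ((2^-1 : R)%:C *: a) = 2^-1 * nrm a.
Proof. by rewrite nrmZr ?invr_ge0. Qed.

Lemma half_double a : (2^-1 : R)%:C *: (a + a) = a.
Proof.
rewrite scalerDr -scalerDl -rmorphD /= (_ : 2^-1 + 2^-1 = 1 :> R) ?scale1r //.
by field.
Qed.

(* [b] is the limit of the iteration [b <- (x + b^2)/2] from [0], whose increments
   are dominated by those of the scalar iteration [t <- (1 + t^2)/2]. *)
Section SquareRoot.
Context (x : A).

Fixpoint sqrt_iter n : A :=
  if n is m.+1 then (2^-1 : R)%:C *: (x + sqrt_iter m ** sqrt_iter m) else 0.

Fixpoint sqrt_bound n : R :=
  if n is m.+1 then (1 + sqrt_bound m ^+ 2) / 2 else 0.

Lemma sqrt_bound_ge0 n : 0 <= sqrt_bound n.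
Proof. by case: n => //= n; rewrite divr_ge0 // addr_ge0 // sqr_ge0. Qed.

(** The gap [g = 1 - t] evolves by [g |-> g (1 - g / 2)], which decays like [2 / n]; this is the
    rate of convergence of the square root iteration. *)
Lemma sqrt_bound_gap n : 0 <= 1 - sqrt_bound n <= 2 / n.+1%:R.
Proof.
elim: n => [|n /andP[]] /=; first by rewrite subr0 ler01 divr1 ler1n.
set t := sqrt_bound n => t1 tn.
have -> : 1 - (1 + t ^+ 2) / 2 = (1 - t) * (1 + t) / 2 by field.
have t0 : 0 <= t := sqrt_bound_ge0 n.
apply/andP; split; first by rewrite divr_ge0 // mulr_ge0 // addr_ge0.
rewrite ler_pdivlMr ?ltr0n //.
have n0 : 0 < n.+1%:R :> R by rewrite ltr0n.
move: tn; rewrite ler_pdivlMr // => tn.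
rewrite -[n.+2]addn1 natrD; nra.
Qed.

Lemma sqrt_bound_homo m n : (m <= n)%N -> sqrt_bound m <= sqrt_bound n.
Proof.
move=> mn; rewrite -(subnK mn); elim: (n - m)%N => //= k /le_trans; apply.
(* One scalar step increases [t] by [(1 - t)^2 / 2]. *)
by have := sqr_ge0 (1 - sqrt_bound (k + m)); lra.
Qed.

Context (x1 : nrm x <= 1).

Lemma nrm_sqrt_iter n : nrm (sqrt_iter n) <= sqrt_bound n.
Proof.
elim: n => [|n IH] /=; first by rewrite nrm0.
rewrite nrm_half mulrC ler_wpM2r ?invr_ge0 //.
apply: le_trans (nrmD _ _) _; rewrite lerD // (le_trans (nrm_cmul _ _)) //.
by rewrite expr2 ler_pM ?nrm_ge0.
Qed.

(** The factorization [b^2 - c^2 = b (b - c) + (b - c) c] holds without commutativity and is matched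
    term by term by the one for the scalar bounds. *)
Lemma nrm_sqrt_iterB m n : (m <= n)%N ->
  nrm (sqrt_iter n - sqrt_iter m) <= sqrt_bound n - sqrt_bound m.
Proof.
elim: m n => [|m IH] [|n] // mn; rewrite ?subr0 ?nrm_sqrt_iter //=.
rewrite -scalerBr nrm_half.
set b := sqrt_iter n; set c := sqrt_iter m.
have -> : x + b ** b - (x + c ** c) = b ** (b - c) + (b - c) ** c.
  by rewrite cmulBr cmulBl subrKA opprD addrACA subrr add0r.
have bc := IH n mn; rewrite -/b -/c in bc.
have bN := nrm_sqrt_iter n; have cN := nrm_sqrt_iter m; rewrite -/b -/c in bN cN.
have h1 : nrm (b ** (b - c)) <= sqrt_bound n * (sqrt_bound n - sqrt_bound m).
  by apply: le_trans (nrm_cmul _ _) _; rewrite ler_pM ?nrm_ge0.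
have h2 : nrm ((b - c) ** c) <= (sqrt_bound n - sqrt_bound m) * sqrt_bound m.
  by apply: le_trans (nrm_cmul _ _) _; rewrite ler_pM ?nrm_ge0.
have := nrmD (b ** (b - c)) ((b - c) ** c); nra.
Qed.

(** The equation is [(1 - b)^2 = 1 - x] written without a unit. Each clause holds, exactly or up to
    one step, for the iterates and passes to the limit. *)
Lemma one_sub_sqrt : selfadj x -> exists b,
  [/\ selfadj b, nrm b <= 1, b + b = x + b ** b &
      forall c, c ** x = x ** c -> c ** b = b ** c].
Proof.
move=> sax; pose e n : R := 1 - sqrt_bound n.
have e_small (t : R) : 0 < t -> exists n, e n < t.
  move=> t0; exists (Num.truncn (2 / t)).
  apply: le_lt_trans (andP (sqrt_bound_gap _)).2 _.
  by rewrite ltr_pdivrMr ?ltr0n // mulrC -ltr_pdivrMr // truncnS_gt.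
have cauchy m n : (m <= n)%N -> nrm (sqrt_iter n - sqrt_iter m) <= e m.
  move=> /nrm_sqrt_iterB/le_trans; apply; rewrite lerB //.
  by have /andP[] := sqrt_bound_gap n; rewrite subr_ge0.
have [b be] := complete_nrm e_small cauchy.
(* Each of the remaining clauses is an equality, proved by bounding the difference of its two sides
   by a multiple of the error [e n]. *)
have b_lim y z (C : R) : (forall n, nrm (y - z) <= C * e n) -> y = z.
  move=> yC; apply/subr0_eq/nrm_small_eq0 => t t0.
  have C1 : 0 < `|C| + 1 by rewrite ltr_wpDl.
  have [n en] := e_small _ (divr_gt0 t0 C1).
  apply: le_trans (yC n) _; rewrite ltr_pdivlMr // in en.
  have en0 : 0 <= e n by have /andP[] := sqrt_bound_gap n.
  by have := ler_norm C; nra.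
have b1 : nrm b <= 1.
  by have := be 0%N; rewrite /e /= !subr0.
exists b; split => //.
- apply: (b_lim _ _ 2) => n.
  have sa_n : star (sqrt_iter n) = sqrt_iter n.
    by elim: n => [|n IH] /=; rewrite ?star0 // starZr starD starM IH sax.
  rewrite -(subrKA (sqrt_iter n)) -{1}sa_n -starB.
  apply: le_trans (nrmD _ _) _; rewrite nrm_star (nrmBC _ b).
  by have := be n; lra.
- apply: (b_lim _ _ 4) => n.
  have step : sqrt_iter n.+1 + sqrt_iter n.+1 = x + sqrt_iter n ** sqrt_iter n.
    by rewrite /= -scalerDr half_double.
  (* The recursion links iterate [n.+1] on the linear side to iterate [n] on the quadratic side, so
     the defect is a difference of the two errors. *)
  have -> : b + b - (x + b ** b) = (b - sqrt_iter n.+1) + (b - sqrt_iter n.+1)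
      - (b ** (b - sqrt_iter n) + (b - sqrt_iter n) ** sqrt_iter n).
    rewrite cmulBr cmulBl subrKA addrACA -opprD step -[RHS]addrA.
    by rewrite -opprD -(addrA x) subrKC.
  have h1 : nrm (b ** (b - sqrt_iter n)) <= e n.
    apply: le_trans (nrm_cmul _ _) _; rewrite -[leRHS]mul1r.
    by rewrite ler_pM ?nrm_ge0.
  have h2 : nrm ((b - sqrt_iter n) ** sqrt_iter n) <= e n.
    apply: le_trans (nrm_cmul _ _) _; rewrite -[leRHS]mulr1.
    rewrite ler_pM ?nrm_ge0 //; apply: le_trans (nrm_sqrt_iter n) _.
    by have /andP[] := sqrt_bound_gap n; rewrite subr_ge0.
  have h3 := be n.+1; have h4 : e n.+1 <= e n.
    by rewrite /e lerB // sqrt_bound_homo.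
  apply: le_trans (nrmB _ _) _; have := nrmD (b ** (b - sqrt_iter n))
    ((b - sqrt_iter n) ** sqrt_iter n).
  by have := nrmD (b - sqrt_iter n.+1) (b - sqrt_iter n.+1); lra.
- move=> c cx; apply: (b_lim _ _ (2 * nrm c)) => n.
  have c_n : c ** sqrt_iter n = sqrt_iter n ** c.
    elim: n => [|n IH] /=; first by rewrite -(scale0r x) cmulZl cmulZr cx.
    by rewrite cmulZl cmulZr cmulDl cmulDr cx cmulA IH -!cmulA IH.
  rewrite -(subrKA (c ** sqrt_iter n)) -cmulBr c_n -cmulBl.
  apply: le_trans (nrmD _ _) _.
  have := nrm_cmul c (b - sqrt_iter n); have := nrm_cmul (sqrt_iter n - b) c.
  rewrite (nrmBC (sqrt_iter n)).
  by have := be n; have := nrm_ge0 c; nra.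
Qed.

End SquareRoot.

(** The hypothesis says that the formal element [1 + v] satisfies [star (1 + v) (1 + v) = 1], so
    left multiplication by it preserves [star z ** z]. *)
Lemma nrm_formal_unitary v z :
  v + star v + star v ** v = 0 -> nrm (z + v ** z) = nrm z.
Proof.
move=> vu; apply/eqP; rewrite -(@eqrXn2 _ 2) ?nrm_ge0 //; apply/eqP.
rewrite -!nrm_star_cmul; congr nrm.
rewrite -[RHS]addr0 -(cmul0r (star z)) -(cmul0l z) -vu.
by rewrite starD starM !(cmulDl, cmulDr) !cmulA !addrA.
Qed.

End CStarNorm.

(** * A faithful representation is isometric *)

Section Representation.
Context (R : realType) (A : cstarType R) (H : completeNormedModType R[i]).
Context (dot : {dot H for conjC}) (hilbH : is_hilbert dot).
Context (pi : A -> H -> H) (rep : faithful_nondegenerate_rep dot pi).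
Implicit Types (a b c d s z : A) (x y : H).

Lemma rep_bounded a : bounded_op (pi a).
Proof. by case: rep. Qed.

Lemma rep_lin a : linear (pi a).
Proof. by case: (rep_bounded a). Qed.

Lemma rep_linear x : linear (fun a => pi a x : H).
Proof. by case: rep => _ []. Qed.

Lemma repB a b x : pi (a - b) x = pi a x - pi b x.
Proof. exact: (linB (rep_linear x)). Qed.

Lemma repD a b x : pi (a + b) x = pi a x + pi b x.
Proof. exact: (linD (rep_linear x)). Qed.

Lemma repZ k a x : pi (k *: a) x = k *: pi a x.
Proof. exact: (linZ (rep_linear x)). Qed.

Lemma rep0 x : pi 0 x = 0.
Proof. exact: (lin0 (rep_linear x)). Qed.

Lemma repM a b x : pi (a ** b) x = pi a (pi b x).
Proof. by case: rep => _ []. Qed.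

Lemma rep_adjoint a : is_adjoint dot (pi a) (pi (star a)).
Proof. by case: rep. Qed.

Lemma rep_inj : injective pi.
Proof. by case: rep. Qed.

Lemma rep_eq0 a : (forall x, pi a x = 0) -> a = 0.
Proof. by move=> a0; apply: rep_inj; apply/funext => x; rewrite a0 rep0. Qed.

(* With [1 - c*c = (1 - b)^2], the difference [|x|^2 - |pi c x|^2] is
   [|x - pi b x|^2]. *)
Lemma rep_le a x : nrm (pi a x) <= nrm a * nrm x.
Proof.
have unit_le c : nrm c <= 1 -> nrm (pi c x) <= nrm x.
  move=> c1; have sac : selfadj (star c ** c) by rewrite /selfadj /= starM starK.
  have cc1 : nrm (star c ** c) <= 1 by rewrite nrm_star_cmul exprn_ile1 ?nrm_ge0.
  have [b [sab _ b_eq _]] := one_sub_sqrt cc1 sac.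
  rewrite -(@ler_pXn2r _ 2) ?nnegrE ?nrm_ge0 // -subr_ge0.
  suff -> : nrm x ^+ 2 - nrm (pi c x) ^+ 2 = nrm (x - pi b x) ^+ 2.
    by rewrite sqr_ge0.
  rewrite (nrmB_sqr hilbH) -2!(rdotxx hilbH) -(rdotxx hilbH (pi b x)).
  rewrite (adjoint_rdot (rep_adjoint c)) (adjoint_rdot (rep_adjoint b)) -!repM sab.
  have : rdot dot x (pi (b + b) x) = rdot dot x (pi (star c ** c + b ** b) x).
    by rewrite b_eq.
  rewrite !repD !rdotDr; lra.
have [a0|a0] := eqVneq (nrm a) 0.
  by rewrite (nrm0_eq0 a0) rep0 !nrm0 mul0r.
have a_gt0 : 0 < nrm a by rewrite lt_def a0 nrm_ge0.
have := unit_le ((nrm a)^-1%:C *: a).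
rewrite repZ !nrmZr ?invr_ge0 ?nrm_ge0 // mulVf // => /(_ (lexx _)).
by rewrite mulrC ler_pdivrMr // mulrC.
Qed.

(* On the spectrum, [s^2 = 1 - (1 - d)^2]; the formal unitaries
   [-i(1 - d) +- s] exhibit [s] as a contraction. *)
Lemma nrm_sine_le1 d s : selfadj d -> selfadj s -> d ** s = s ** d ->
  s ** s + d ** d = d + d -> nrm s <= 1.
Proof.
move=> sad sas ds ss.
(* For [k] equal to [i] or [-i], the formal element [(1 - d) + k s] is unitary because
   [(1 - d)^2 + s^2 = 1]. *)
have unitary (k : R[i]) : conjc k = - k -> k * k = - 1 ->
    forall z, nrm (z + (k *: s - d) ** z) = nrm z.
  move=> kc kk z; apply: nrm_formal_unitary.
  have -> : star (k *: s - d) = - (k *: s + d).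
    by rewrite starB starZ (_ : conjC k = - k) // sad sas scaleNr opprD.
  have -> : k *: s - d - (k *: s + d) = - (s ** s + d ** d).
    by rewrite ss opprD addrACA subrr add0r opprD.
  have -> : - (k *: s + d) ** (k *: s - d) = s ** s + d ** d.
    rewrite cmulNl cmulBr !cmulDl !cmulZl !cmulZr scalerA kk scaleN1r ds.
    by rewrite opprB addrC opprD opprK subrKA.
  by rewrite addNr.
have contr z : nrm (s ** z) <= nrm z.
  have ii : 'i%C * 'i%C = - 1 :> R[i] by rewrite -expr2 sqr_i.
  have ci : conjc 'i%C = - 'i%C :> R[i].
    by apply/eqP; rewrite eq_complex /= oppr0 !eqxx.
  have u1 := unitary 'i%C ci ii z.
  have u2 : nrm (z + (- 'i%C *: s - d) ** z) = nrm z.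
    by apply: unitary; rewrite ?mulrNN // -ci conjcK ci opprK.
  have i1 : cabs ('i%C : R[i]) = 1.
    by rewrite /cabs normc_def /= expr0n expr1n add0r sqrtr1.
  (* The two unitaries differ by [2 i s], so [s] is half a difference of isometries up to a
     phase. *)
  have uu : 'i%C *: (s ** z + s ** z)
      = (z + ('i%C *: s - d) ** z) - (z + (- 'i%C *: s - d) ** z).
    rewrite opprD addrACA subrr add0r -cmulBl opprB subrKA scaleNr opprK.
    by rewrite cmulDl cmulZl scalerDr.
  rewrite -(half_double (s ** z)) nrm_half.
  have <- : nrm ('i%C *: (s ** z + s ** z)) = nrm (s ** z + s ** z).
    by rewrite nrmZ i1 mul1r.
  rewrite uu mulrC ler_pdivrMr // mulr_natr mulr2n; apply: le_trans (nrmB _ _) _.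
  by rewrite u1 u2.
have [->|s0] := eqVneq (nrm s) 0; first exact: ler01.
have s_gt0 : 0 < nrm s by rewrite lt_def s0 nrm_ge0.
by rewrite -(ler_pM2r s_gt0) mul1r -expr2 -nrm_sqr_selfadj.
Qed.

Lemma rep_unit_ball c : selfadj c -> nrm c ^+ 2 <= 2 ->
  (forall x, nrm (pi c x) <= nrm x) -> nrm c <= 1.
Proof.
move=> sac c2 pic1; set d := c ** c.
have sad : selfadj d := selfadj_sqr sac.
(* Formally [(1 - b1)^2 = 1 - c^2 / 2], available because [|c|^2 <= 2]. Then [w = c (1 - b1)]
   satisfies [2 w^2 = 2 d - d^2], and [s], which is [w] times the square root of 2, satisfies
   [s^2 = 1 - (1 - d)^2]. *)
have [b1 [sab1 _ b1_eq b1_comm]] : exists b, [/\ selfadj b, nrm b <= 1,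
    b + b = (2^-1 : R)%:C *: d + b ** b &
    forall a, a ** ((2^-1 : R)%:C *: d) = ((2^-1 : R)%:C *: d) ** a ->
      a ** b = b ** a].
  apply: one_sub_sqrt; last by rewrite /selfadj /= starZr sad.
  by rewrite nrm_half nrm_sqr_selfadj // mulrC ler_pdivrMr // mul1r.
have cb1 : c ** b1 = b1 ** c.
  by apply: b1_comm; rewrite cmulZl cmulZr cmulA.
pose w := c - c ** b1.
have saw : selfadj w by rewrite /selfadj /= starB starM sab1 sac -cb1.
have ww : w ** w + w ** w + d ** d = d + d.
  have -> : w ** w = d - d ** (b1 + b1 - b1 ** b1).
    have cbc : c ** b1 ** c = d ** b1 by rewrite -cmulA -cb1 cmulA.
    rewrite cmulBl !cmulBr cmulDr !cmulA cbc -/d.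
    by rewrite -(addrA (d ** b1)) -[LHS]addrA -opprD.
  rewrite b1_eq addrK addrACA -opprD -(cmulDr d) -scalerDr half_double.
  by rewrite subrK.
have cw : c ** w = w ** c by rewrite cmulBl cmulBr -cmulA -cb1.
have dw : d ** w = w ** d by rewrite -cmulA cw cmulA cw -cmulA.
pose t : R := Num.sqrt 2.
have tt : t * t = 2 by rewrite -expr2 sqr_sqrtr.
pose s := t%:C *: w.
have sas : selfadj s by rewrite /selfadj /= starZr saw.
have ss : s ** s + d ** d = d + d.
  rewrite cmulZl cmulZr scalerA -rmorphM /= tt -ww; congr (_ + _).
  by rewrite -[2]/(1 + 1) rmorphD /= scalerDl scale1r.
have s1 : nrm s <= 1.
  by apply: nrm_sine_le1 sad sas _ ss; rewrite cmulZl cmulZr dw.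
have x1 : nrm (s ** s) <= 1 by rewrite nrm_sqr_selfadj // exprn_ile1 ?nrm_ge0.
(* Now [(1 - b)^2 = 1 - s^2 = (1 - d)^2], so [1 - b] plays the role of [|1 - d|]. *)
have [b [sab bn1 b_eq b_comm]] := one_sub_sqrt x1 (selfadj_sqr sas).
have db : d ** b = b ** d.
  apply: b_comm; have -> : s ** s = d + d - d ** d by rewrite -ss addrK.
  by rewrite cmulBl cmulBr cmulDl cmulDr cmulA.
pose f := d - b.
(* Since [2 d - d^2 = 2 b - b^2] and [d] commutes with [b], [2 (d - b) = (d + b) (d - b)]. *)
have ff : f + f = d ** f + b ** f.
  rewrite !cmulBr db subrKA addrACA -opprD b_eq -ss.
  by rewrite opprD addrACA subrr add0r.
(* Strict convexity: [2 z] is the sum of [pi d z] and [pi b z], both of norm at most [|z|], so the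
   parallelogram law forces them to coincide. *)
have pif x : pi f (pi f x) = 0.
  set z := pi f x.
  have zz : z + z = pi d z + pi b z by rewrite -[LHS]repD ff repD !repM.
  have dz : nrm (pi d z) <= nrm z by rewrite repM; apply: le_trans (pic1 _) _.
  have bz : nrm (pi b z) <= nrm z.
    by apply: le_trans (rep_le _ _) _; rewrite ler_piMl ?nrm_ge0.
  rewrite repB; apply: nrm0_eq0; apply/eqP; rewrite -sqrf_eq0 eq_le sqr_ge0 andbT.
  have := parallelogram hilbH (pi d z) (pi b z); rewrite -zz.
  have -> : z + z = (2 : R)%:C *: z.
    by rewrite -[2]/(1 + 1) rmorphD /= scalerDl scale1r.
  rewrite nrmZr //; have := nrm_ge0 (pi d z); have := nrm_ge0 (pi b z); nra.
have f0 : f = 0.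
  apply: nrm0_eq0; apply/eqP; rewrite -sqrf_eq0 -nrm_sqr_selfadj.
    by rewrite (@rep_eq0 (f ** f)) ?nrm0 // => x; rewrite repM.
  by rewrite /selfadj /= starB sab sad.
have {f0} d_b : d = b by apply: subr0_eq.
by rewrite -(@expr_le1 _ 2) ?nrm_ge0 // -nrm_sqr_selfadj // -/d d_b.
Qed.

(** The self-adjoint case rescales to [rep_unit_ball]; the general case applies it to [star a ** a]
    with bound [C^2]. *)
Lemma rep_lower_bound a (C : R) : 0 <= C ->
  (forall x, nrm (pi a x) <= C * nrm x) -> nrm a <= C.
Proof.
have sa_case c (D : R) : selfadj c -> 0 <= D ->
    (forall x, nrm (pi c x) <= D * nrm x) -> nrm c <= D.
  move=> sac D0 cD.
  have [->//|c0] := eqVneq (nrm c) 0.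
  have c_gt0 : 0 < nrm c by rewrite lt_def c0 nrm_ge0.
  pose t := Num.max D (4 / 5 * nrm c).
  have Dt : D <= t by rewrite le_max lexx.
  have ct : 4 / 5 * nrm c <= t by rewrite le_max lexx orbT.
  have t_gt0 : 0 < t by apply: lt_le_trans ct; rewrite mulr_gt0 // divr_gt0.
  have ti0 : 0 <= t^-1 by rewrite invr_ge0 ltW.
  have : nrm (t^-1%:C *: c) <= 1.
    apply: rep_unit_ball.
    - by rewrite /selfadj /= starZr sac.
    - rewrite nrmZr // mulrC.
      have : nrm c / t <= 5 / 4 by rewrite ler_pdivrMr //; lra.
      have : 0 <= nrm c / t by rewrite divr_ge0 // ltW.
      nra.
    - move=> x; rewrite repZ nrmZr // mulrC ler_pdivrMr // mulrC.
      by apply: le_trans (cD x) _; rewrite ler_wpM2r ?nrm_ge0.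
  rewrite nrmZr // mulrC ler_pdivrMr // mul1r /t le_max => /orP[//|]; lra.
move=> C0 aC; rewrite -(@ler_pXn2r _ 2) ?nnegrE ?nrm_ge0 // -nrm_star_cmul.
apply: sa_case; rewrite ?sqr_ge0 //; first by rewrite /selfadj /= starM starK.
move=> x; rewrite repM expr2 -mulrA.
apply: le_trans (adjoint_le hilbH (rep_adjoint a) aC _) _.
by rewrite ler_wpM2l.
Qed.

End Representation.

(** Absorbs the factor [C] picked up when an approximation is composed with an operator bounded by
    [C]. *)
Lemma le_shrink (R : realFieldType) (C e u t : R) : 0 <= C -> 0 <= u -> 0 < e ->
  t <= C * (e / (C + 1) * u) -> t <= e * u.
Proof.
move=> C0 u0 e0 /le_trans; apply; rewrite mulrA ler_wpM2r // mulrCA.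
by rewrite ler_piMr ?(ltW e0) // ler_pdivrMr ?mul1r ?lerDl // ltr_wpDl.
Qed.

(** * Commutators, their adjoints and operator-norm closure *)

Section Commutator.
Context (R : realType) (H : completeNormedModType R[i]).
Context (dot : {dot H for conjC}) (hilbH : is_hilbert dot).
Implicit Types S T X : H -> H.

Lemma bounded_commutator S T :
  bounded_op S -> bounded_op T -> bounded_op (commutator S T).
Proof. by move=> bS bT; apply: bounded_opB; apply: bounded_op_comp. Qed.

Lemma commutatorN S T x : commutator S T x = - commutator T S x.
Proof. by rewrite /commutator opprB. Qed.

Lemma adjoint_comp S S' T T' : is_adjoint dot S S' -> is_adjoint dot T T' ->
  is_adjoint dot (S \o T) (T' \o S').
Proof. by move=> SS' TT' x y; rewrite /= SS' TT'. Qed.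

Lemma adjointB S S' T T' : is_adjoint dot S S' -> is_adjoint dot T T' ->
  is_adjoint dot (S \- T) (S' \- T').
Proof. by move=> SS' TT' x y; rewrite /= linearBl linearBr /= SS' TT'. Qed.

Lemma adjoint_commutator S S' T T' :
  is_adjoint dot S S' -> is_adjoint dot T T' ->
  is_adjoint dot (commutator S T) (commutator T' S').
Proof.
by move=> SS' TT'; apply: adjointB; apply: adjoint_comp.
Qed.

Lemma opnorm_eq S T : (forall x, nrm (S x) = nrm (T x)) -> opnorm S = opnorm T.
Proof. by move=> ST; congr ereal_sup; apply: eq_imagel => x _; rewrite ST. Qed.

Lemma opnorm_adjoint_le T T' :
  bounded_op T -> is_adjoint dot T T' -> (opnorm T' <= opnorm T)%E.
Proof.
move=> bT TT'; have [lT Tfin] := bT.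
have fT : opnorm T \is a fin_num by rewrite ge0_fin_numE ?opnorm_ge0.
rewrite -(fineK fT); apply/opnorm_leP.
- exact: adjoint_linear TT'.
- by rewrite fine_ge0 ?opnorm_ge0.
apply: (adjoint_le hilbH TT'); apply/opnorm_leP; rewrite ?fineK //.
by rewrite fine_ge0 ?opnorm_ge0.
Qed.

Lemma op_closure_bounded (F : set (H -> H)) T : op_closure F T -> bounded_op T.
Proof. by case. Qed.

Lemma op_closure_approx (F : set (H -> H)) T (e : R) :
  F `<=` @bounded_op R H H -> op_closure F T -> 0 < e ->
  exists2 S, F S & forall x, nrm (T x - S x) <= e * nrm x.
Proof.
move=> Fb [bT FT] e0; have [S FS TS] := FT _ e0; exists S => //.
have lTS : linear (T \- S) by case: (bounded_opB bT (Fb _ FS)).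
exact: ((opnorm_leP lTS (ltW e0)).1 TS).
Qed.

End Commutator.

(** * The relative commutant of the Roe algebra inside the multipliers *)

Section HigsonCompactification.
Context (R : realType) (A U : cstarType R) (iota : A -> U) (L : U -> \bar R).
Context (H : completeNormedModType R[i]).
Context (dot : {dot H for conjC}) (hilbH : is_hilbert dot).
Context (pi : A -> H -> H) (rep : faithful_nondegenerate_rep dot pi).
Implicit Types (a b : A) (S T X : H -> H).

Lemma Ccomm_approx T (e : R) : Ccomm iota L pi T -> 0 < e ->
  exists S, [/\ bounded_op S, (Lstar iota L pi S < +oo)%E,
    locally_compact_op pi S & forall x, nrm (T x - S x) <= e * nrm x].
Proof.
move=> cT e0; have [|S [bS LS lcS] TS] := op_closure_approx _ cT e0.
  by move=> S [].
by exists S.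
Qed.

(** Multiplying by a fixed [pi a] is norm continuous and compact operators are norm closed, so local
    compactness passes to the closure. *)
Lemma Ccomm_locally_compact T : Ccomm iota L pi T -> locally_compact_op pi T.
Proof.
move=> cT a; have bT : bounded_op T := op_closure_bounded cT.
have ba := rep_bounded rep a; have /bounded_opP[la [C C0 aC]] := ba.
have C1 : 0 < C + 1 by rewrite ltr_wpDl.
split; apply: compact_op_limit; try exact: bounded_op_comp; move=> e e0;
  have [S [bS _ lcS TS]] := Ccomm_approx cT (divr_gt0 e0 C1).
  exists (S \o pi a) => [|x /=]; first by case: (lcS a).
  apply: (le_shrink C0 (nrm_ge0 _) e0); apply: le_trans (TS _) _.
  by rewrite mulrCA ler_wpM2l // ltW // divr_gt0.
exists (pi a \o S) => [|x /=]; first by case: (lcS a).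
rewrite -linB //; apply: (le_shrink C0 (nrm_ge0 _) e0); apply: le_trans (aC _) _.
by rewrite ler_wpM2l.
Qed.

(** [Lstar] tests only self-adjoint [a], for which [[S', pi a]] is minus the adjoint of
    [[S, pi a]]. *)
Lemma Lstar_adjoint_le S S' : bounded_op S -> is_adjoint dot S S' ->
  (Lstar iota L pi S' <= Lstar iota L pi S)%E.
Proof.
move=> bS SS'; apply: ge_ereal_sup => _ [a [sa La] <-].
apply: (@le_trans _ _ (opnorm (commutator S (pi a)))); last first.
  by apply: ereal_sup_ubound; exists a.
rewrite (@opnorm_eq _ _ _ (commutator (pi a) S')); last first.
  by move=> x; rewrite commutatorN nrmN.
apply: (opnorm_adjoint_le hilbH).
  exact: bounded_commutator bS (rep_bounded rep a).
by apply: adjoint_commutator => //; rewrite -{2}sa; apply: (rep_adjoint rep).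
Qed.

Lemma locally_compact_op_adjoint S S' : is_adjoint dot S S' ->
  locally_compact_op pi S -> locally_compact_op pi S'.
Proof.
move=> SS' lcS a; have [lcl lcr] := lcS (star a).
have adj_a : is_adjoint dot (pi (star a)) (pi a).
  by rewrite -{2}(starK a); apply: (rep_adjoint rep).
by split; [apply: (compact_op_adjoint hilbH) lcr|
           apply: (compact_op_adjoint hilbH) lcl];
  apply: adjoint_comp.
Qed.

Lemma Ccomm_adjoint T T' :
  is_adjoint dot T T' -> Ccomm iota L pi T -> Ccomm iota L pi T'.
Proof.
move=> TT' cT; have bT := op_closure_bounded cT; split.
  exact: (bounded_op_adjoint hilbH TT').
move=> e e0; have [S [bS LS lcS TS]] := Ccomm_approx cT e0.
have [S' SS'] := adjoint_exists hilbH bS; exists S'.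
  split; first exact: (bounded_op_adjoint hilbH SS').
    exact: le_lt_trans (Lstar_adjoint_le bS SS') LS.
  exact: locally_compact_op_adjoint SS' lcS.
have TS' := adjointB TT' SS'.
apply/(opnorm_leP (adjoint_linear hilbH TS') (ltW e0)).
exact: (adjoint_le hilbH TS' TS).
Qed.

(** The lower bound makes the approximants Cauchy in [A] itself; contractivity of [pi] then
    identifies the image of their limit with [T]. *)
Lemma rep_range_closed T :
    (forall e : R, 0 < e -> exists a, forall x, nrm (T x - pi a x) <= e * nrm x) ->
  exists a, T = pi a.
Proof.
move=> lim_T; pose d n : R := n.+1%:R^-1.
have d_gt0 n : 0 < d n by rewrite invr_gt0.
have /choice[a aT] n : exists a, forall x, nrm (T x - pi a x) <= d n * nrm x.
  exact: lim_T.
have d_small e : 0 < e -> exists n, 2 * d n < e.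
  move=> e0; exists (Num.truncn (2 / e)); rewrite ltr_pdivrMr ?ltr0n //.
  by rewrite mulrC -ltr_pdivrMr // truncnS_gt.
have a_cauchy m n : (m <= n)%N -> nrm (a n - a m) <= 2 * d m.
  move=> mn; apply: (rep_lower_bound hilbH rep) => [|x].
    by rewrite mulr_ge0 // (ltW (d_gt0 m)).
  rewrite (repB rep); apply: le_trans (nrm_distD (T x) _ _) _.
  have dnm : d n <= d m by rewrite lef_pV2 ?posrE // ler_nat.
  have := aT m x; have := aT n x; rewrite (nrmBC (pi (a n) x)).
  have := ler_wpM2r (nrm_ge0 x) dnm; lra.
have [l al] := complete_nrm d_small a_cauchy.
exists l; apply/funext => x; apply/subr0_eq/nrm_small_eq0 => e e0.
have x1 : 0 < 2 * (nrm x + 1) by rewrite mulr_gt0 // ltr_wpDl // nrm_ge0.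
have [n dn] := d_small _ (divr_gt0 e0 x1).
apply: le_trans (nrm_distD (pi (a n) x) _ _) _; rewrite -(repB rep).
have := aT n x; have := rep_le hilbH rep (a n - l) x; have := al n.
rewrite (nrmBC (a n)) => /(ler_wpM2r (nrm_ge0 x)); move: dn.
by rewrite ltr_pdivlMr //; have := nrm_ge0 x; have := d_gt0 n; lra.
Qed.

Lemma multiplier_bounded S : multiplier pi S -> bounded_op S.
Proof. by case. Qed.

Lemma multiplier_rep a : multiplier pi (pi a).
Proof.
split=> [|b]; first exact: rep_bounded rep a.
split; [exists (a ** b)|exists (b ** a)];
  by apply/funext => x; rewrite (repM rep).
Qed.

Lemma multiplier_id : multiplier pi id.
Proof. by split=> [|a]; [exact: bounded_op_id|split; exists a]. Qed.

Lemma multiplierD S T :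
  multiplier pi S -> multiplier pi T -> multiplier pi (S \+ T).
Proof.
move=> [bS mS] [bT mT]; split=> [|a]; first exact: bounded_opD.
have [[b Sa] [c aS]] := mS a; have [[d Ta] [e aT]] := mT a.
split; [exists (b + d)|exists (c + e)]; apply/funext => x; rewrite (repD rep).
  by rewrite -Sa -Ta.
by rewrite -aS -aT /= linD //; exact: rep_lin rep a.
Qed.

Lemma multiplier_comp S T :
  multiplier pi S -> multiplier pi T -> multiplier pi (S \o T).
Proof.
move=> [bS mS] [bT mT]; split=> [|a]; first exact: bounded_op_comp.
split.
  by have [[b Ta] _] := mT a; have [[c Sb] _] := mS b; exists c; rewrite -Sb -Ta.
by have [_ [b aS]] := mS a; have [_ [c bT']] := mT b; exists c; rewrite -bT' -aS.
Qed.

Lemma multiplierZ (k : R[i]) S :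
  multiplier pi S -> multiplier pi (fun x => k *: S x).
Proof.
move=> [bS mS]; split=> [|a]; first exact: bounded_opZ.
have [[b Sa] [c aS]] := mS a.
split; [exists (k *: b)|exists (k *: c)]; apply/funext => x; rewrite (repZ rep).
  by rewrite -Sa.
by rewrite -aS /= linZ //; exact: rep_lin rep a.
Qed.

(** [S' pi a] is the adjoint of [pi (star a) S], so the left and right conditions are exchanged. *)
Lemma multiplier_adjoint S S' :
  is_adjoint dot S S' -> multiplier pi S -> multiplier pi S'.
Proof.
move=> SS' [bS mS]; split=> [|a]; first exact: bounded_op_adjoint SS' bS.
have adj_a : is_adjoint dot (pi (star a)) (pi a).
  by rewrite -{2}(starK a); apply: (rep_adjoint rep).
have [[b Sa] [c aS]] := mS (star a); split; [exists (star c)|exists (star b)].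
  apply: (adjoint_unique hilbH (adjoint_comp adj_a SS')).
  by rewrite aS; apply: (rep_adjoint rep).
apply: (adjoint_unique hilbH (adjoint_comp SS' adj_a)).
by rewrite Sa; apply: (rep_adjoint rep).
Qed.

Lemma multiplier_limit S : bounded_op S ->
  (forall e : R, 0 < e -> exists2 T, multiplier pi T &
     forall x, nrm (S x - T x) <= e * nrm x) ->
  multiplier pi S.
Proof.
move=> bS lim_S; split=> // a.
have a1 : 0 < nrm a + 1 by rewrite ltr_wpDl // nrm_ge0.
split; apply: rep_range_closed => e e0;
  have [T [_ mT] ST] := lim_S _ (divr_gt0 e0 a1).
  have [[b Ta] _] := mT a; exists b => x; rewrite -Ta /=.
  apply: (le_shrink (nrm_ge0 a) (nrm_ge0 _) e0); apply: le_trans (ST _) _.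
  rewrite mulrCA ler_wpM2l ?(ltW (divr_gt0 e0 a1)) //.
  exact: (rep_le hilbH rep).
have [_ [b aT]] := mT a; exists b => x.
rewrite -aT /= -linB; last exact: rep_lin rep a.
apply: (le_shrink (nrm_ge0 a) (nrm_ge0 _) e0).
apply: le_trans (rep_le hilbH rep a _) _.
by rewrite ler_wpM2l ?nrm_ge0.
Qed.

Let higson := higson_comm iota L pi.

Lemma higson_multiplier S : higson S -> multiplier pi S.
Proof. by case. Qed.

Lemma higson_id : higson id.
Proof.
split=> [|X _]; first exact: multiplier_id.
rewrite (_ : commutator id X = fun=> 0); first exact: compact_op0.
by apply/funext => x; rewrite /commutator subrr.
Qed.

(** Both products in the commutator are already compact, by local compactness of [X]. *)
Lemma higson_rep a : higson (pi a).
Proof.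
split=> [|X /Ccomm_locally_compact/(_ a)[Xa aX]]; first exact: multiplier_rep.
exact: compact_opB aX Xa.
Qed.

Lemma higsonD S T : higson S -> higson T -> higson (S \+ T).
Proof.
move=> [mS cS] [mT cT]; split=> [|X cX]; first exact: multiplierD.
rewrite (_ : commutator _ X = commutator S X \+ commutator T X).
  exact: compact_opD (cS X cX) (cT X cX).
apply/funext => x; rewrite /commutator /= linD; last by case: cX => [[]].
by rewrite opprD addrACA.
Qed.

Lemma higson_comp S T : higson S -> higson T -> higson (S \o T).
Proof.
move=> [mS cS] [mT cT]; split=> [|X cX]; first exact: multiplier_comp.
have bS := multiplier_bounded mS; have bT := multiplier_bounded mT.
(* The commutator with [X] is a derivation, and compact operators form an ideal. *)
rewrite (_ : commutator _ X = (S \o commutator T X) \+ (commutator S X \o T)).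
  apply: compact_opD; first exact: compact_op_compl bS (cT X cX).
  exact: compact_op_compr (cS X cX) bT.
by apply/funext => x; rewrite /commutator /= (linB bS.1) subrKA.
Qed.

Lemma higsonZ (k : R[i]) S : higson S -> higson (fun x => k *: S x).
Proof.
move=> [mS cS]; split=> [|X cX]; first exact: multiplierZ.
rewrite (_ : commutator _ X = fun x => k *: commutator S X x).
  exact: compact_opZ (cS X cX).
by apply/funext => x; rewrite /commutator (linZ (op_closure_bounded cX).1) scalerBr.
Qed.

(** [[S', X]] is minus the adjoint of [[S, X']], where the adjoint [X'] of [X] again lies in
    [Ccomm]. *)
Lemma higson_adjoint S S' : is_adjoint dot S S' -> higson S -> higson S'.
Proof.
move=> SS' [mS cS]; split=> [|X cX]; first exact: multiplier_adjoint SS' mS.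
have [X' XX'] := adjoint_exists hilbH (op_closure_bounded cX).
have cX' := Ccomm_adjoint XX' cX.
have adj := adjoint_commutator SS' (adjoint_sym XX').
have := compact_opZ (- 1) (compact_op_adjoint hilbH adj (cS X' cX')).
congr compact_op; apply/funext => x.
by rewrite scaleN1r -commutatorN.
Qed.

Lemma higson_closed : op_closure higson `<=` higson.
Proof.
move=> S clS; have bS := op_closure_bounded clS.
have approx (e : R) (e0 : 0 < e) := op_closure_approx
  (fun T hT => multiplier_bounded (higson_multiplier hT)) clS e0.
split.
  apply: multiplier_limit => // e /approx[T [mT _] ST].
  by exists T.
move=> X cX; have bX := op_closure_bounded cX.
have /bounded_opP[lX [C C0 XC]] := bX.
apply: compact_op_limit; first exact: bounded_commutator.
move=> e e0; have C1 : 0 < C + 1 by rewrite ltr_wpDl.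
(* [[S, X] - [T, X] = [S - T, X]] has two terms, each bounded by [C] times the distance of [T] from
   [S]. *)
have d0 : 0 < e / (2 * (C + 1)) by rewrite divr_gt0 // mulr_gt0.
have [T [_ cT] ST] := approx _ d0.
exists (commutator T X) => [|x]; first exact: cT.
have -> : commutator S X x - commutator T X x =
    (S (X x) - T (X x)) - X (S x - T x).
  by rewrite /commutator (linB lX) opprD addrACA -opprD.
apply: le_trans (nrmB _ _) _.
have h1 := le_trans (ST (X x)) (ler_wpM2l (ltW d0) (XC x)).
have h2 := le_trans (XC (S x - T x)) (ler_wpM2l C0 (ST x)).
apply: le_trans (lerD h1 h2) _.
have -> : e / (2 * (C + 1)) * (C * nrm x) + C * (e / (2 * (C + 1)) * nrm x)
  = e * nrm x * (C / (C + 1)) by field; rewrite gt_eqF.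
by rewrite ler_piMr ?mulr_ge0 ?nrm_ge0 ?(ltW e0) // ler_pdivrMr // mul1r lerDl.
Qed.

End HigsonCompactification.

Theorem theorem4p7 (R : realType) (A U M : cstarType R)
    (iota : A -> U) (one : U) (j : M -> A) (L : U -> \bar R)
    (AML : proper_lc_quantum_metric_space iota one j L)
    (H : completeNormedModType R[i]) (dot : {dot H for conjC})
    (hilbH : is_hilbert dot)
    (pi : A -> H -> H) (repA : faithful_nondegenerate_rep dot pi) :
  nc_coarse_space dot pi (higson_comm iota L pi).
Proof.
split; last by move=> _ [a _ <-]; exact: (higson_rep _ _ repA).
split.
- exact: higson_multiplier.
- exact: higson_id.
- split=> [S T hS hT|k S hS]; last exact: (higsonZ repA).
  by split; [apply: (higsonD repA)|apply: higson_comp].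
- move=> S hS.
  have [S' SS'] := adjoint_exists hilbH (multiplier_bounded (higson_multiplier hS)).
  by exists S' => //; apply: (higson_adjoint hilbH repA SS').
- exact: (higson_closed hilbH repA).
Qed.
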